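(* Let $G$ be a connected undirected graph, $c:E(G)\to\mathbb{R}_{>0}$, $\mathcal{T}\subseteq V(G)$, $r\in\mathcal{T}$ and $L$ a valid lower bound. Consider the Dijkstra–Steiner algorithm (described in the context) modified so that, immediately after each update of a label $(w,I)$ by an edge step, it executes $\mathrm{prune}(w,I)$, and immediately after each update of a label $(v,I\cup J)$ by a merge step, it executes $\mathrm{prune}(v,I\cup J)$. Here $\mathrm{prune}(x,K)$ removes $(x,K)$ from $N$ only if there is no optimum Steiner tree $T$ for $\mathcal{T}$ such that $\mathrm{backtrack}(x,K)$ is the edge set of an $(x,K)$-subtree of $T$ (and otherwise leaves $N$ unchanged). Then the modified algorithm still terminates and returns the edge set of an optimum Steiner tree for $\mathcal{T}$ in $G$.
   Context: $\mathrm{smt}(X)$ is the minimum cost of a tree in $G$ containing $X\subseteq V(G)$; a Steiner tree for $\mathcal{T}$ is a tree containing $\mathcal{T}$, optimum if its cost is $\mathrm{smt}(\mathcal{T})$. A function $L:V(G)\times 2^{\mathcal{T}}\to\mathbb{R}_{\ge0}$ is a valid lower bound (w.r.t. $r$) if $L(r,\{r\})=0$ and $L(v,I)\le L(w,I')+\mathrm{smt}((I\setminus I')\cup\{v,w\})$ for all $v,w$ and all $\{r\}\subseteq I'\subseteq I\subseteq\mathcal{T}$. For a Steiner tree $T$ for $\mathcal{T}$, a tree $T_1$ is a $(v,I)$-subtree of $T$ if there is a tree $T_2$ with $V(T_1)\cup V(T_2)=V(T)$, $V(T_1)\cap V(T_2)=\{v\}$, $T_1$ a subtree of $T$ containing $\{v\}\cup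 I$, and $T_2$ a subtree of $T$ containing $\{v\}\cup(\mathcal{T}\setminus I)$. Dijkstra–Steiner algorithm. Labels are pairs $(v,I)\in V(G)\times 2^{\mathcal{T}\setminus\{r\}}$ with values $l(v,I)$ and backtracking data $b(v,I)$. Initialize $l\equiv\infty$; then $l(s,\{s\})=0$ for $s\in\mathcal{T}\setminus\{r\}$; $l(v,\emptyset)=0$ for all $v$; $b\equiv\emptyset$; $N=\{(s,\{s\}):s\in\mathcal{T}\setminus\{r\}\}$; $P=V(G)\times\{\emptyset\}$. While $(r,\mathcal{T}\setminus\{r\})\notin P$: choose $(v,I)\in N$ minimizing $l(v,I)+L(v,\mathcal{T}\setminus I)$; move it from $N$ to $P$; edge step: for every edge $e=\{v,w\}$, if $l(v,I)+c(e)<l(w,I)$ and $(w,I)\notin P$, set $l(w,I):=l(v,I)+c(e)$, $b(w,I):=\{(v,I)\}$, add $(w,I)$ to $N$; merge step: for every nonempty $J\subseteq(\mathcal{T}\setminus\{r\})\setminus I$ with $(v,J)\in P$, if $l(v,I)+l(v,J)<l(v,I\cup J)$ and $(v,I\cup J)\notin P$, set $l(v,I\cup J):=l(v,I)+l(v,J)$, $b(v,I\cup J):=\{(v,I),(v,J)\}$, add $(v,I\cup J)$ to $N$. Finally return $\mathrm{backtrack}(r,\mathcal{T}\setminus\{r\})$, where $\mathrm{backtrack}(v,I)=\{\{v,w\}\}\cup\mathrm{backtrack}(w,I)$ if $b(v,I)=\{(w,I)\}$, and otherwise $\bigcup_{(w,I')\in b(v,I)}\mathrm{backtrack}(w,I')$.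 *)

(* Defs.v *)
From Stdlib Require Export Relation_Operators.
From mathcomp Require Export all_boot all_order all_algebra.
From mathcomp Require Export boolp reals constructive_ereal.

Set Implicit Arguments.
Unset Strict Implicit.
Unset Printing Implicit Defensive.

Import Order.TTheory GRing.Theory Num.Theory.
Local Open Scope ring_scope.

(* A finite simple graph is a pair (vertex set, edge set), an edge being the
   two-element set of its endpoints. *)
Definition graph (V : finType) : finType := ({set V} * {set {set V}})%type.

Definition is_graph (V : finType) (H : graph V) : Prop :=
  forall e, e \in H.2 -> #|e| = 2%N /\ e \subset H.1.

Definition adj (V : finType) (F : {set {set V}}) : rel V :=
  fun x y => [set x; y] \in F.

Definition connected_graph (V : finType) (H : graph V) : Prop :=
  H.1 != set0 /\ forall x y, x \in H.1 -> y \in H.1 -> connect (adj H.2) x y.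

Definition acyclic (V : finType) (H : graph V) : Prop :=
  forall p : seq V, (2 < size p)%N -> ~ ucycle (adj H.2) p.

Definition is_tree (V : finType) (H : graph V) : Prop :=
  [/\ is_graph H, connected_graph H & acyclic H].

Definition subtree (V : finType) (H1 H : graph V) : Prop :=
  [/\ is_tree H1, H1.1 \subset H.1 & H1.2 \subset H.2].

(* From here on the ambient graph is G = ([set: V], E), and the cost function
   c : E(G) -> R is a function on {set V} that is only used on members of E. *)

Definition cost (R : realType) (V : finType) (c : {set V} -> R) (H : graph V) : R :=
  \sum_(e in H.2) c e.

Definition steiner_tree (V : finType) (E : {set {set V}}) (X : {set V})
    (H : graph V) : Prop :=
  subtree H ([set: V], E) /\ X \subset H.1.

(* The minimum over a finite family, +oo if that family is empty; it is finite
   when G is connected. *)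
Definition smt (R : realType) (V : finType) (E : {set {set V}})
    (c : {set V} -> R) (X : {set V}) : \bar R :=
  \big[Order.min/+oo%E]_(H : graph V | `[< steiner_tree E X H >]) (cost c H)%:E.

Definition optimum_steiner_tree (R : realType) (V : finType) (E : {set {set V}})
    (c : {set V} -> R) (T : {set V}) (H : graph V) : Prop :=
  steiner_tree E T H /\ (cost c H)%:E = smt E c T.

(* Only the values of L on subsets of T are constrained. *)
Definition valid_lower_bound (R : realType) (V : finType) (E : {set {set V}})
    (c : {set V} -> R) (T : {set V}) (r : V) (L : V -> {set V} -> R) : Prop :=
  [/\ forall v (I : {set V}), I \subset T -> 0 <= L v I,
      L r [set r] = 0
    & forall v w (I I' : {set V}),
        [set r] \subset I' -> I' \subset I -> I \subset T ->
        ((L v I)%:E <= (L w I')%:E + smt E c ((I :\: I') :|: [set v; w]))%E].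

(* H1 is a (v, I)-subtree of the Steiner tree H for T. *)
Definition label_subtree (V : finType) (T : {set V}) (H : graph V)
    (v : V) (I : {set V}) (H1 : graph V) : Prop :=
  exists H2 : graph V,
    [/\ H1.1 :|: H2.1 = H.1,
        H1.1 :&: H2.1 = [set v],
        subtree H1 H /\ [set v] :|: I \subset H1.1
      & subtree H2 H /\ [set v] :|: (T :\: I) \subset H2.1].

Definition label (V : finType) : finType := (V * {set V})%type.

Record state (R : realType) (V : finType) : Type := State {
  lval : label V -> \bar R;
  bptr : label V -> {set label V};
  queue : {set label V};      (* N *)
  perm_set : {set label V}    (* P *)
}.

Definition init_state (R : realType) (V : finType) (T : {set V}) (r : V) :
    state R V :=
  let N := [set (s, [set s]) | s in T :\ r] in
  let P := [set (v, set0) | v in [set: V]] in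
  {| lval := fun k => if (k \in N) || (k \in P) then 0%E else +oo%E;
     bptr := fun=> set0;
     queue := N;
     perm_set := P |}.

(* backtrack b k F : the recursive procedure backtrack, called on the label k
   with backtracking data b, terminates and returns the edge set F. *)
Inductive backtrack (V : finType) (b : label V -> {set label V}) :
    label V -> {set {set V}} -> Prop :=
| backtrack_edge v w I F :
    b (v, I) = [set (w, I)] -> backtrack b (w, I) F ->
    backtrack b (v, I) ([set v; w] |: F)
| backtrack_union v I (F : label V -> {set {set V}}) :
    (forall w, b (v, I) <> [set (w, I)]) ->
    (forall k, k \in b (v, I) -> backtrack b k (F k)) ->
    backtrack b (v, I) (\bigcup_(k in b (v, I)) F k).

Definition in_optimum (R : realType) (V : finType) (E : {set {set V}})
    (c : {set V} -> R) (T : {set V}) (b : label V -> {set label V})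
    (k : label V) : Prop :=
  exists H, optimum_steiner_tree E c T H /\
  exists H1, label_subtree T H k.1 k.2 H1 /\ backtrack b k H1.2.

(* prune is nondeterministic: it never has to remove a label, and may remove k
   only when in_optimum fails. *)
Definition prune (R : realType) (V : finType) (E : {set {set V}})
    (c : {set V} -> R) (T : {set V}) (k : label V) (s s' : state R V) : Prop :=
  s' = s \/
  (~ in_optimum E c T (bptr s) k /\
   s' = {| lval := lval s; bptr := bptr s;
           queue := queue s :\ k; perm_set := perm_set s |}).

(* The common part of the edge and merge steps: try to give the label k the
   value x with backtracking data B, and prune k if it was updated. *)
Definition relax (R : realType) (V : finType) (E : {set {set V}})
    (c : {set V} -> R) (T : {set V}) (k : label V) (x : \bar R)
    (B : {set label V}) (s s' : state R V) : Prop :=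
  if (x < lval s k)%E && (k \notin perm_set s)
  then prune E c T k
         {| lval := [eta lval s with k |-> x];
            bptr := [eta bptr s with k |-> B];
            queue := k |: queue s;
            perm_set := perm_set s |} s'
  else s' = s.

Definition edge_update (R : realType) (V : finType) (E : {set {set V}})
    (c : {set V} -> R) (T : {set V}) (v : V) (I : {set V}) (w : V)
    (s s' : state R V) : Prop :=
  relax E c T (w, I) (lval s (v, I) + (c [set v; w])%:E)%E [set (v, I)] s s'.

Definition merge_update (R : realType) (V : finType) (E : {set {set V}})
    (c : {set V} -> R) (T : {set V}) (v : V) (I J : {set V})
    (s s' : state R V) : Prop :=
  relax E c T (v, I :|: J) (lval s (v, I) + lval s (v, J))%E
    [set (v, I); (v, J)] s s'.

Fixpoint run_seq (S A : Type) (body : A -> S -> S -> Prop) (xs : seq A)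
    (s s' : S) : Prop :=
  if xs is x :: xs' then exists2 s1, body x s s1 & run_seq body xs' s1 s'
  else s' = s.

(* A "for every x in D" loop, with an arbitrary order of traversal. *)
Definition for_every (S : Type) (A : finType) (D : {set A})
    (body : A -> S -> S -> Prop) (s s' : S) : Prop :=
  exists2 xs, perm_eq xs (enum D) & run_seq body xs s s'.

Definition chosen (R : realType) (V : finType) (T : {set V})
    (L : V -> {set V} -> R) (s : state R V) (k : label V) : Prop :=
  k \in queue s /\
  forall k', k' \in queue s ->
    (lval s k + (L k.1 (T :\: k.2))%:E <= lval s k' + (L k'.1 (T :\: k'.2))%:E)%E.

Definition iteration (R : realType) (V : finType) (E : {set {set V}})
    (c : {set V} -> R) (T : {set V}) (r : V) (L : V -> {set V} -> R)
    (s s' : state R V) : Prop :=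
  exists v I, chosen T L s (v, I) /\
  let s0 := {| lval := lval s; bptr := bptr s;
               queue := queue s :\ (v, I);
               perm_set := (v, I) |: perm_set s |} in
  exists s1,
    for_every [set w | [set v; w] \in E] (edge_update E c T v I) s0 s1 /\
    for_every [set J : {set V} | [&& J != set0, J \subset (T :\ r) :\: I
                                  & (v, J) \in perm_set s1]]
      (merge_update E c T v I) s1 s'.

Definition finished (R : realType) (V : finType) (T : {set V}) (r : V)
    (s : state R V) : Prop :=
  (r, T :\ r) \in perm_set s.


Definition loop_step (R : realType) (V : finType) (E : {set {set V}})
    (c : {set V} -> R) (T : {set V}) (r : V) (L : V -> {set V} -> R)
    (s s' : state R V) : Prop :=
  ~ finished T r s /\ iteration E c T r L s s'.

(* Main.v *)
From mathcomp Require Import lra.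
Require Import Defs.

(* A label (v, I) matters only if it has an optimal split: edge sets F1, joining
   v to I, and F2, joining v to T \ I, of total cost at most smt(T).  Since costs
   are positive, F1 is then the edge set of a (v, I)-subtree of an optimum Steiner
   tree, and any set that joins v to I and costs no more than F1 can take its
   place.  Hence a label whose value has come down to the cost of such an F1 is
   never pruned.  If a label with an optimal split is not yet permanent, taking
   F1 apart edge by edge leads to such a label in the queue whose key is, by
   validity of L, at most c(F1) + L(v, T \ I).  So the queue cannot run empty, and
   a label that has an optimal split is correct when it is chosen. *)

Set Implicit Arguments.
Unset Strict Implicit.
Unset Printing Implicit Defensive.

Import Order.TTheory GRing.Theory Num.Theory.
Local Open Scope ring_scope.

(** * Connectivity within an edge set *)

Definition reach (V : finType) (F : {set {set V}}) (v : V) (X : {set V}) : bool :=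
  [forall x in X, connect (adj F) v x].

(** All of [F] is kept as edge set, including edges that [v] does not reach, so this is a graph only
    if there are no such edges; minimal connecting sets have none. *)
Definition component (V : finType) (F : {set {set V}}) (v : V) : graph V :=
  ([set x | connect (adj F) v x], F).

Section Reach.
Variable V : finType.
Implicit Types (F : {set {set V}}) (I X Y : {set V}) (u v w x y : V).

Lemma connect_adj_sym F x y : connect (adj F) x y = connect (adj F) y x.
Proof. by apply: sym_connect_sym => a b; rewrite /adj setUC. Qed.

Lemma connect_restrict (e e' : rel V) x y :
    (forall z t, connect e x z -> e z t -> e' z t) ->
  connect e x y -> connect e' x y.
Proof.
move=> sub_e /connectP[p]; elim/last_ind: p y => [|p z IHp] y.
  by move=> _ ->; apply: connect0.
rewrite rcons_path last_rcons => /andP[ep ez] ->.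
apply: (connect_trans (IHp _ ep erefl)); apply: connect1; apply: sub_e => //.
by apply/connectP; exists p.
Qed.

Lemma connect_adjS F F' x y :
  F \subset F' -> connect (adj F) x y -> connect (adj F') x y.
Proof.
by move=> sFF'; apply: connect_restrict => z t _; apply: (subsetP sFF').
Qed.

Lemma connect_adj1 F x y : [set x; y] \in F -> connect (adj F) x y.
Proof. exact: (@connect1 _ (adj F)). Qed.

Lemma connect_bypass F a b x y :
    connect (adj (F :\ [set a; b])) a b -> connect (adj F) x y ->
  connect (adj (F :\ [set a; b])) x y.
Proof.
move=> cab; apply: connect_sub => z t Fzt.
have [/setP zt_ab|neq] := eqVneq [set z; t] [set a; b]; last first.
  by apply: connect_adj1; rewrite !inE neq.
have: (z \in [set a; b]) && (t \in [set a; b]) by rewrite -!zt_ab !inE !eqxx orbT.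
by case/andP => /set2P[]-> /set2P[]->; rewrite ?connect0 // connect_adj_sym.
Qed.

Lemma path_avoid F u t a p :
    path (adj F) a p -> u \notin a :: p -> path (adj (F :\ [set u; t])) a p.
Proof.
elim: p a => //= b p IHp a /andP[Fab Fp]; rewrite !inE !negb_or.
case/and3P=> ua ub up; rewrite IHp ?inE ?negb_or ?ub // andbT.
rewrite /adj !inE [_ \in F]Fab andbT.
apply: contra_neq ua => /setP/(_ u); rewrite !inE eqxx /=.
by rewrite (negPf ub) orbF => /eqP.
Qed.

(** Induction along a path from [v]: the current vertex is always joined to [v] or to [w] without
    the edge between them, since taking that edge ends at one of the two. *)
Lemma connect_setD1 F v w x :
    connect (adj F) v x ->
  connect (adj (F :\ [set v; w])) v x || connect (adj (F :\ [set v; w])) w x.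
Proof.
set F' := F :\ _; case/connectP => p Fp ->{x}.
suff: forall z, connect (adj F') v z || connect (adj F') w z -> path (adj F) z p ->
    connect (adj F') v (last z p) || connect (adj F') w (last z p).
  by apply=> //; rewrite connect0.
elim: p {Fp} => //= t p IHp z vwz /andP[zt]; apply: IHp.
have [/setP def_e|neq] := eqVneq [set z; t] [set v; w].
  have: t \in [set v; w] by rewrite -def_e !inE eqxx orbT.
  by case/set2P=> ->; rewrite connect0 ?orbT.
have F'zt: connect (adj F') z t by apply: connect_adj1; rewrite !inE neq.
by case/orP: vwz => /connect_trans/(_ F'zt) ->; rewrite ?orbT.
Qed.

Lemma reachP F v X :
  reflect (forall x, x \in X -> connect (adj F) v x) (reach F v X).
Proof. exact: forall_inP. Qed.

Lemma reachS F F' v X X' :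
  F \subset F' -> X' \subset X -> reach F v X -> reach F' v X'.
Proof.
move=> sF /subsetP sX /reachP vX; apply/reachP => x /sX/vX.
exact: connect_adjS.
Qed.

Lemma reach_trans F v w X :
  connect (adj F) v w -> reach F w X -> reach F v X.
Proof. by move=> vw /reachP wX; apply/reachP => x /wX; apply: connect_trans. Qed.

Lemma reachU F v X Y : reach F v (X :|: Y) = reach F v X && reach F v Y.
Proof.
apply/reachP/andP=> [vXY | [/reachP vX /reachP vY] x].
  by split; apply/reachP => x xXY; apply: vXY; rewrite inE xXY ?orbT.
by case/setUP; auto.
Qed.

Lemma reachUD F1 F2 v I X :
  reach F1 v I -> reach F2 v (X :\: I) -> reach (F1 :|: F2) v X.
Proof.
move=> vI vD; apply: (@reachS _ _ _ (I :|: (X :\: I))) (subxx _) _ _.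
  by apply/subsetP => x Xx; rewrite !inE Xx andbT orbN.
by rewrite reachU (reachS _ _ vI) ?subsetUl // (reachS _ _ vD) ?subsetUr.
Qed.

Lemma reach1 F v x : reach F v [set x] = connect (adj F) v x.
Proof.
by apply/reachP/idP=> [|vx y /set1P->//]; apply; rewrite inE.
Qed.

Lemma mem_component F v x : (x \in (component F v).1) = connect (adj F) v x.
Proof. by rewrite inE. Qed.

End Reach.

(** * Minimal connecting edge sets are Steiner trees *)

Section Trees.
Variables (V : finType) (E : {set {set V}}).
Hypothesis hG : is_graph ([set: V], E).
Implicit Types (F : {set {set V}}) (X : {set V}).

(** Minimality excludes both obstructions: an edge that [v] does not reach could be dropped, and an
    edge on a cycle could be bypassed along the rest of the cycle. *)
Lemma reach_min_tree F v X :
    F \subset E -> reach F v X ->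
    (forall e, e \in F -> ~~ reach (F :\ e) v X) ->
  steiner_tree E X (component F v).
Proof.
move=> sFE vX Fmin.
have FinC e : e \in F -> #|e| = 2%N /\ e \subset (component F v).1.
  move=> Fe; have [-> _] := hG (subsetP sFE _ Fe); split=> //.
  apply/subsetPn => -[x ex /=]; rewrite inE => vx.
  case/negP: (Fmin _ Fe); apply/reachP => y /(reachP _ _ _ vX).
  apply: connect_restrict => z t vz Fzt; rewrite /adj !inE [_ \in F]Fzt andbT.
  apply: contraNneq vx => def_e; move: ex; rewrite -def_e => /set2P[]-> //.
  exact: connect_trans vz (connect1 Fzt).
split; last first.
  by apply/subsetP => x Xx; rewrite inE; apply: (reachP _ _ _ vX).
split; rewrite ?subsetT //.
split=> //.
  split; first by apply/set0Pn; exists v; rewrite inE connect0.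
  move=> x y; rewrite !inE /= => vx; apply: connect_trans.
  by rewrite connect_adj_sym.
case=> [|x [|y [|z p]]] //= _ /andP[/= /and3P[Fxy Fyz Fp]].
rewrite !inE !negb_or -!andbA => /and5P[xy xz xp yz yp_].
case/andP: yp_ => yp _.
case/negP: (Fmin _ Fxy); apply/reachP => t /(reachP _ _ _ vX).
apply: connect_bypass; rewrite connect_adj_sym.
apply: (@connect_trans _ _ z).
  (* This edge survives the deletion because the cycle has at least three distinct vertices, so [z]
     is neither [x] nor [y]. *)
  apply: connect_adj1; rewrite !inE [_ \in F]Fyz andbT.
  apply/eqP => /setP/(_ z); rewrite !inE eqxx orbT.
  by rewrite eq_sym (negPf xz) eq_sym (negPf yz).
rewrite setUC; apply/connectP; exists (rcons p x); last by rewrite last_rcons.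
by apply: path_avoid => //; rewrite inE mem_rcons inE !negb_or yz eq_sym xy.
Qed.

Lemma reach_steiner_tree F v X :
    F \subset E -> reach F v X ->
  exists2 F' : {set {set V}}, F' \subset F & steiner_tree E X (component F' v).
Proof.
move=> sFE vX.
have [F' /(@minsetP _ (fun F : {set {set V}} => reach F v X))[vX' F'min] sF'F] :=
  @minset_exists _ (fun F : {set {set V}} => reach F v X) F vX.
exists F' => //; apply: reach_min_tree => // [|e F'e].
  exact: subset_trans sFE.
apply/negP => vXe; have := F'min _ vXe (subD1set _ _).
by move/setP/(_ e); rewrite !inE eqxx F'e.
Qed.

End Trees.

(** * Edge weights, [smt] and optimal splits *)

Definition weight (R : realType) (V : finType) (c : {set V} -> R)
    (F : {set {set V}}) : R :=
  \sum_(e in F) c e.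

(** Only connectivity and total cost are asked, so that one side can be exchanged freely; optimality
    and positive costs force the sides to be disjoint trees meeting in one vertex. *)
Definition optimal_split (R : realType) (V : finType) (E : {set {set V}})
    (c : {set V} -> R) (T : {set V}) (k : label V) (F1 F2 : {set {set V}}) :
    Prop :=
  [/\ F1 \subset E, F2 \subset E, reach F1 k.1 k.2, reach F2 k.1 (T :\: k.2)
    & ((weight c F1 + weight c F2)%:E <= smt E c T)%E].

Section Weight.
Variables (R : realType) (V : finType) (E : {set {set V}}) (c : {set V} -> R).
Hypothesis hG : is_graph ([set: V], E).
Hypothesis hconn : connected_graph ([set: V], E).
Hypothesis hc : forall e, e \in E -> 0 < c e.
Implicit Types (F : {set {set V}}) (X T : {set V}).
Local Notation w := (weight c).

Lemma weight_ge0 F : F \subset E -> 0 <= w F.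
Proof. by move=> /subsetP sF; apply: sumr_ge0 => e /sF/hc/ltW. Qed.

Lemma weightD1 F e : e \in F -> w F = c e + w (F :\ e).
Proof. by move=> Fe; rewrite /weight (big_setD1 e). Qed.

Lemma ltr_weightD1 F e : F \subset E -> e \in F -> w (F :\ e) < w F.
Proof.
by move=> /subsetP sF Fe; rewrite (weightD1 Fe) ltrDr hc // sF.
Qed.

Lemma weightS F F' : F' \subset E -> F \subset F' -> w F <= w F'.
Proof.
move=> sF' sFF'; rewrite /weight [leRHS](big_setID F) /= (setIidPr sFF') lerDl.
apply: weight_ge0; apply: subset_trans sF'; exact: subsetDl.
Qed.

Lemma weightUD F F' : w (F :|: F') = w F + w (F' :\: F).
Proof.
rewrite /weight (big_setID F) /= (setIidPr (subsetUl _ _)).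
by rewrite setDUl setDv set0U.
Qed.

Lemma weightU F F' : F' \subset E -> w (F :|: F') <= w F + w F'.
Proof. by move=> sF'; rewrite weightUD lerD2l weightS // subsetDl. Qed.

Lemma weightU1 F e : F \subset E -> e \in E -> w (e |: F) <= c e + w F.
Proof.
move=> sF Ee; apply: le_trans (weightU _ sF) _.
by rewrite {1}/weight big_set1.
Qed.

(** [F] may contain cycles and stray edges; thinning it to a tree does not raise the cost. *)
Lemma smt_le F v X : F \subset E -> reach F v X -> (smt E c X <= (w F)%:E)%E.
Proof.
move=> sF vX; have [F' sF' stF'] := reach_steiner_tree hG sF vX.
have le_smt : (smt E c X <= (w F')%:E)%E.
  by apply: (@bigmin_le_cond _ _ _ _ (component F' v)); apply/asboolP.
by apply: le_trans le_smt _; rewrite lee_fin weightS.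
Qed.

Lemma reach_total v X : reach E v X.
Proof.
by apply/reachP => x _; have [_] := hconn; apply; rewrite /= inE.
Qed.

(** Connectivity of the graph makes the family of Steiner trees nonempty, so the minimum is attained
    and is not the default [+oo]. *)
Lemma smt_attained v X : v \in X ->
  exists F, [/\ F \subset E, reach F v X & ((w F)%:E <= smt E c X)%E].
Proof.
move=> Xv; have [F _ stF] := reach_steiner_tree hG (subxx E) (reach_total v X).
have [|H /asboolP[[[_ [_ Hconn] _] /= _ sHE] XH] smtE] :=
    @eq_bigmin _ _ _ +oo%E _ (fun H => `[< steiner_tree E X H >])
      (fun H => (cost c H)%:E) (asboolT stF).
  by move=> H _; apply: leey.
exists H.2; split=> //; last by rewrite /smt smtE.
by apply/reachP => x Xx; apply: Hconn; apply: (subsetP XH).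
Qed.

Section Optimum.
Variables (T : {set V}) (v : V).

Lemma optimum_D1 F e :
    F \subset E -> ((w F)%:E <= smt E c T)%E -> e \in F ->
  ~~ reach (F :\ e) v T.
Proof.
move=> sF Fopt Fe; apply/negP => vT.
have: (smt E c T <= (w (F :\ e))%:E)%E.
  by apply: smt_le vT; apply: subset_trans sF; apply: subD1set.
by apply/negP; rewrite -ltNge (lt_le_trans _ Fopt) // lte_fin ltr_weightD1.
Qed.

Lemma reach_optimum F :
    F \subset E -> reach F v T -> ((w F)%:E <= smt E c T)%E ->
  optimum_steiner_tree E c T (component F v).
Proof.
move=> sF vT Fopt; split; last first.
  by apply/le_anti; rewrite [X in X && _]Fopt; apply: smt_le vT.
by apply: reach_min_tree => // e; apply: optimum_D1.
Qed.

Variables (I : {set V}) (F1 F2 : {set {set V}}).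
Hypothesis spl : optimal_split E c T (v, I) F1 F2.

Lemma split_reach : reach (F1 :|: F2) v T.
Proof.
case: spl => _ _ vI vD _; exact: reachUD vI vD.
Qed.

Lemma split_weight : ((w (F1 :|: F2))%:E <= smt E c T)%E.
Proof.
by case: spl => _ sF2 _ _; apply: le_trans; rewrite lee_fin weightU.
Qed.

Lemma split_subset : F1 :|: F2 \subset E.
Proof. by case: spl => ? ? _ _ _; rewrite subUset; apply/andP. Qed.

(** A shared edge would be paid twice in the sum but once in the union, and the union would then
    cost less than [smt]. *)
Lemma split_disjoint e : e \in F1 -> e \notin F2.
Proof.
case: spl => sF1 sF2 _ _ opt F1e; apply/negP => F2e.
have: (smt E c T <= (w (F1 :|: F2))%:E)%E by apply: smt_le split_subset split_reach.
apply/negP; rewrite -ltNge (lt_le_trans _ opt) // lte_fin weightUD ltrD2l.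
apply: le_lt_trans (ltr_weightD1 sF2 F2e); apply: weightS.
  by apply: subset_trans sF2; apply: subD1set.
apply/subsetP => f; rewrite !inE => /andP[F1f ->]; rewrite andbT.
by apply: contraNneq F1f => ->.
Qed.

End Optimum.
End Weight.

(** * From optimal splits to subtrees of optimum Steiner trees *)

Section LabelSubtree.
Variables (R : realType) (V : finType) (E : {set {set V}}) (c : {set V} -> R).
Hypothesis hG : is_graph ([set: V], E).
Hypothesis hc : forall e, e \in E -> 0 < c e.
Variables (T : {set V}) (v : V) (I : {set V}) (F1 F2 : {set {set V}}).
Hypothesis spl : optimal_split E c T (v, I) F1 F2.
Local Notation w := (weight c).

(** [G1] and [G2] together connect [T], so they cost at least [smt]. Keeping one side of the split
    fixed then shows that the other side is a cheapest choice. *)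
Lemma split_min (G1 G2 : {set {set V}}) :
    G1 \subset E -> G2 \subset E -> reach G1 v I -> reach G2 v (T :\: I) ->
  w F1 + w F2 <= w G1 + w G2.
Proof.
move=> sG1 sG2 vI vD; rewrite -lee_fin.
case: spl => _ _ _ _ opt; apply: le_trans opt _.
apply: le_trans (smt_le hG hc _ (reachUD vI vD)) _; first by rewrite subUset sG1.
by rewrite lee_fin (weightU hc).
Qed.

Lemma split_trees :
  steiner_tree E I (component F1 v) /\ steiner_tree E (T :\: I) (component F2 v).
Proof.
case: spl => sF1 sF2 /= vI vD _.
split; apply: reach_min_tree => // e Fe; apply/negP => red.
  have := split_min (subset_trans (subD1set _ e) sF1) sF2 red vD.
  by apply/negP; rewrite -ltNge ltrD2r (ltr_weightD1 hc).
have := split_min sF1 (subset_trans (subD1set _ e) sF2) vI red.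
by apply/negP; rewrite -ltNge ltrD2l (ltr_weightD1 hc).
Qed.

(** For the nontrivial inclusion, the last edge of a path lies in [F1] or [F2], and each of these
    sets has all its edges within its own component. *)
Lemma split_component :
  (component F1 v).1 :|: (component F2 v).1 = (component (F1 :|: F2) v).1.
Proof.
have [[[[g1 _ _] _ _] _] [[[g2 _ _] _ _] _]] := split_trees.
apply/eqP; rewrite eqEsubset subUset; apply/andP; split.
  apply/andP; split; apply/subsetP => x; rewrite !inE; apply: connect_adjS.
    exact: subsetUl.
  exact: subsetUr.
apply/subsetP => x; rewrite mem_component => /connectP[p].
case/lastP: p => [_ ->|p y]; first by rewrite !inE connect0.
rewrite rcons_path last_rcons => /andP[_ Fy] ->.
have ye : y \in [set last v p; y] by rewrite !inE eqxx orbT.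
rewrite inE; case/setUP: Fy => Fy.
  by rewrite (subsetP (g1 _ Fy).2 _ ye).
by rewrite (subsetP (g2 _ Fy).2 _ ye) orbT.
Qed.

(* If a vertex other than v were common, the first edge of a path to it in F1
   could be bypassed through F2. *)
Lemma split_meet : (component F1 v).1 :&: (component F2 v).1 = [set v].
Proof.
apply/setP => x; rewrite !inE; apply/andP/eqP=> [[v1x v2x]|->]; last first.
  by rewrite connect0.
case/connectP: v1x v2x => p0.
case/shortenP => [[_ _ _ ->//|b p /= /andP[F1vb F1p] up _ {p0}]] -> v2x.
case/andP: up => vp _.
have := optimum_D1 hG hc v (split_subset spl) (split_weight hc spl)
  (subsetP (subsetUl F1 F2) _ F1vb).
case/negP; apply/reachP => y /(reachP _ _ _ (split_reach spl)).
apply: connect_bypass; apply: (@connect_trans _ _ (last b p)).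
  apply: connect_adjS v2x; apply/subsetP => e F2e.
  rewrite !inE F2e orbT andbT; apply: contraTneq F2e => ->.
  exact: (split_disjoint hG hc spl F1vb).
rewrite connect_adj_sym; apply: (@connect_adjS _ (F1 :\ [set v; b])).
  by rewrite setSD // subsetUl.
by apply/connectP; exists p => //; apply: path_avoid.
Qed.

(** The union of the two sides is the optimum tree and [F2] spans the complementary subtree; this is
    the form in which [in_optimum] asks for [F1]. *)
Lemma split_label_subtree :
  exists H, optimum_steiner_tree E c T H /\
  exists H1, label_subtree T H v I H1 /\ H1.2 = F1.
Proof.
exists (component (F1 :|: F2) v); split.
  apply: reach_optimum => //; [exact: split_subset spl | exact: split_reach spl |].
  exact: split_weight spl.
exists (component F1 v); split=> //; exists (component F2 v).
have [[[t1 _ _] sI] [[t2 _ _] sD]] := split_trees.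
split; [exact: split_component | exact: split_meet | | ].
  split; last by rewrite subUset sI andbT sub1set inE connect0.
  by split; rewrite ?subsetUl // -split_component subsetUl.
split; last by rewrite subUset sD andbT sub1set inE connect0.
by split; rewrite ?subsetUr // -split_component subsetUr.
Qed.
End LabelSubtree.

(** * Separating the component of a vertex from the other edges *)

Section Decompose.
Variables (R : realType) (V : finType) (c : {set V} -> R).
Variable F : {set {set V}}.
Variable v : V.

Definition near_part : {set {set V}} :=
  [set e in F | [exists x in e, connect (adj F) v x]].

Lemma near_part_reach X : reach F v X -> reach near_part v X.
Proof.
move/reachP => vX; apply/reachP => x /vX.
apply: connect_restrict => z t vz zt; rewrite /adj inE [_ \in F]zt.
by apply/exists_inP; exists z => //; rewrite !inE eqxx.
Qed.

Lemma far_part_reach w X :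
  ~~ connect (adj F) v w -> reach F w X -> reach (F :\: near_part) w X.
Proof.
move=> vw /reachP wX; apply/reachP => x /wX.
apply: connect_restrict => z t wz zt; rewrite /adj !inE [_ \in F]zt andbT.
apply/exists_inPn => u /set2P[]->; apply: contra vw => vu.
  by apply: connect_trans vu _; rewrite connect_adj_sym.
apply: connect_trans vu _; rewrite connect_adj_sym.
exact: connect_trans wz (connect1 zt).
Qed.

Lemma weight_near_far : weight c F = weight c near_part + weight c (F :\: near_part).
Proof.
rewrite /weight (big_setID near_part) /=; congr (_ + _).
by rewrite (setIidPr _) //; apply/subsetP => e; rewrite inE => /andP[].
Qed.
End Decompose.

(** * Backtracking and loops *)

Section Backtrack.
Variables (V : finType) (b : label V -> {set label V}).

Lemma backtrack_fun k F F' : backtrack b k F -> backtrack b k F' -> F = F'.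
Proof.
move=> bF; elim: bF F' => {k F} [v w I F bvI _ IHF | v I F nbvI _ IHF] F' bF';
  inversion bF' as [v' w' I' F1 bvI' bF1 | v' I' F1 nbvI' bF1]; subst.
- by move: bvI'; rewrite bvI => /set1_inj[eq_w]; subst; rewrite (IHF _ bF1).
- by case: (nbvI' w).
- by case: (nbvI w').
- by apply: eq_bigr => k bk; apply: IHF => //; apply: bF1.
Qed.

(* Backtracking data point to permanent labels only, so [k0] is a label that is
   not yet permanent. *)
Lemma backtrack_update b' k0 :
    (forall k, k != k0 -> b' k = b k) -> (forall k, k0 \notin b k) ->
  forall k F, backtrack b k F -> k != k0 -> backtrack b' k F.
Proof.
move=> eq_b nb_k0 k F bF.
have neq k1 k2 : k1 \in b k2 -> k1 != k0 by apply: contraTneq => ->.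
elim: bF => {k F} [v w I F bvI _ IHF | v I F nbvI _ IHF] kk0.
  apply: (@backtrack_edge _ _ v w I); rewrite ?eq_b //; apply: IHF.
  by rewrite (neq _ (v, I)) ?bvI ?set11.
rewrite -eq_b //; apply: backtrack_union => [w|k]; rewrite eq_b // => bk.
by apply: IHF => //; apply: neq bk.
Qed.

Lemma backtrack_leaf k : b k = set0 -> backtrack b k set0.
Proof.
case: k => v I bvI.
have -> : set0 = \bigcup_(k in b (v, I)) set0 :> {set {set V}} by rewrite bvI big_set0.
apply: backtrack_union => [w|k]; rewrite bvI ?inE //.
by move/setP/(_ (w, I)); rewrite !inE eqxx.
Qed.

Lemma backtrack_merge k k1 k2 F1 F2 :
    b k = [set k1; k2] -> k1 != k2 -> backtrack b k1 F1 -> backtrack b k2 F2 ->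
  backtrack b k (F1 :|: F2).
Proof.
case: k => v I bk neq12 bF1 bF2.
pose F k := if k == k1 then F1 else F2.
have -> : F1 :|: F2 = \bigcup_(k in b (v, I)) F k.
  by rewrite bk big_setU1 ?inE //= big_set1 /F eqxx eq_sym (negPf neq12).
apply: backtrack_union => [w|k]; rewrite bk.
  (* Two distinct labels do not form a singleton, so the edge case of backtracking does not
     apply. *)
  by move/(congr1 (fun A : {set label V} => #|A|)); rewrite cards1 cards2 neq12.
by case/set2P=> ->; rewrite /F ?eqxx // eq_sym (negPf neq12).
Qed.
End Backtrack.

Section RunSeq.
Variables (S : Type) (A : finType) (body : A -> S -> S -> Prop).

(** [Q] is the loop invariant; [Post x] is established by the pass for [x] and survives every other
    pass, so the order of traversal is irrelevant. *)
Lemma for_every_post (D : {set A}) (Q : S -> Prop) (Post : A -> S -> Prop) s s' :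
    (forall x s s', x \in D -> Q s -> body x s s' ->
       [/\ Q s', Post x s' & forall y, Post y s -> Post y s']) ->
    Q s -> for_every D body s s' ->
  Q s' /\ forall x, x \in D -> Post x s'.
Proof.
move=> step Qs [xs Dxs run].
have sub x : x \in xs -> x \in D by rewrite (perm_mem Dxs) mem_enum.
suff [Qs' [_ post]] : Q s' /\ (forall y, Post y s -> Post y s') /\
    forall x, x \in xs -> Post x s'.
  by split=> // x Dx; apply: post; rewrite (perm_mem Dxs) mem_enum.
elim: xs sub s Qs run {Dxs} => [|x xs IHxs] /= sub s Qs; first by move->.
case=> s1 xs1 run.
have [Qs1 px mono] := step _ _ _ (sub x (mem_head _ _)) Qs xs1.
have subxs y : y \in xs -> y \in D by move=> xsy; apply: sub; rewrite inE xsy orbT.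
have [Qs' [mono' post]] := IHxs subxs s1 Qs1 run.
split=> //; split=> [y /mono/mono' //|y].
by case/predU1P => [->|/post //]; apply: mono'.
Qed.

Lemma for_every_total (D : {set A}) :
  (forall x s, exists s', body x s s') -> forall s, exists s', for_every D body s s'.
Proof.
move=> tot s; suff [s' run] : exists s', run_seq body (enum D) s s'.
  by exists s', (enum D).
elim: (enum D) s => [|x xs IHxs] s /=; first by exists s.
have [s1 xs1] := tot x s; have [s' run] := IHxs s1.
by exists s', s1.
Qed.
End RunSeq.

(** * Invariants *)

(** Only an inequality, because sets joined by a merge may share edges and the value then exceeds
    the cost. *)
Definition realizes (R : realType) (V : finType) (E : {set {set V}})
    (c : {set V} -> R) (b : label V -> {set label V}) (k : label V) (x : \bar R) :
    Prop :=
  exists F, [/\ backtrack b k F, F \subset E, reach F k.1 k.2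
              & ((weight c F)%:E <= x)%E].

(* [split_kept] is the property that pruning must preserve: an update needs a
   strict decrease, so a label dropped at the cost of an optimal split would never
   come back. *)
Record labels_ok (R : realType) (V : finType) (E : {set {set V}})
    (c : {set V} -> R) (T : {set V}) (r : V) (s : state R V) : Prop := {
  queue_fresh : forall k, k \in queue s -> k \notin perm_set s;
  queue_sub : forall k, k \in queue s -> k.2 \subset T :\ r;
  lval_realized : forall k, (lval s k < +oo)%E -> realizes E c (bptr s) k (lval s k);
  bptr_perm : forall k, bptr s k \subset perm_set s;
  split_kept : forall k F1 F2, optimal_split E c T k F1 F2 ->
    (lval s k <= (weight c F1)%:E)%E -> (k \in queue s) || (k \in perm_set s);
  split_perm : forall k F1 F2, optimal_split E c T k F1 F2 -> k \in perm_set s ->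
    (lval s k <= (weight c F1)%:E)%E;
  perm_empty : forall v, (v, set0) \in perm_set s;
  lval_terminal : forall t, t \in T :\ r -> (lval s (t, [set t]) <= 0)%E
}.

(** A permanent target is exempt, because relaxation no longer changes it. *)
Definition edge_closed (R : realType) (V : finType) (c : {set V} -> R)
    (s : state R V) (v : V) (I : {set V}) (w : V) : Prop :=
  (w, I) \in perm_set s \/
  (lval s (w, I) <= lval s (v, I) + (c [set v; w])%:E)%E.

Definition merge_closed (R : realType) (V : finType) (s : state R V) (v : V)
    (I J : {set V}) : Prop :=
  (v, I :|: J) \in perm_set s \/
  (lval s (v, I :|: J) <= lval s (v, I) + lval s (v, J))%E.

Record invariant (R : realType) (V : finType) (E : {set {set V}})
    (c : {set V} -> R) (T : {set V}) (r : V) (s : state R V) : Prop := {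
  inv_labels : labels_ok E c T r s;
  inv_edge : forall v w (I : {set V}), [set v; w] \in E -> (v, I) \in perm_set s ->
    edge_closed c s v I w;
  inv_merge : forall v (I J : {set V}), I != set0 -> J != set0 -> I \subset T :\ r ->
    J \subset (T :\ r) :\: I -> (v, I) \in perm_set s -> (v, J) \in perm_set s ->
    merge_closed s v I J
}.

Definition refines (R : realType) (V : finType) (s s' : state R V) : Prop :=
  [/\ perm_set s' = perm_set s, forall k, (lval s' k <= lval s k)%E
    & forall k, k \in perm_set s -> lval s' k = lval s k].

(** * Updates and pruning preserve the label properties *)

Section Algorithm.
Variables (R : realType) (V : finType) (E : {set {set V}}) (c : {set V} -> R).
Variables (T : {set V}) (r : V).
Hypothesis hG : is_graph ([set: V], E).
Hypothesis hc : forall e, e \in E -> 0 < c e.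
Local Notation w := (weight c).
Local Notation st := (state R V).
Implicit Types (s : st) (k : label V) (I J : {set V}) (F : {set {set V}}).

Lemma refines_refl s : refines s s.
Proof. by split. Qed.

Lemma refines_trans s1 s2 s3 : refines s1 s2 -> refines s2 s3 -> refines s1 s3.
Proof.
move=> [P12 l12 e12] [P23 l23 e23]; split=> [|k|k Pk]; first by rewrite P23.
  exact: le_trans (l12 k).
by rewrite e23 ?e12 // P12.
Qed.

(** Only [split_kept] is at risk. If the value of the removed label is at most the cost of the first
    side of an optimal split, the backtracked set can replace that side, so [in_optimum] holds and
    the removal was not allowed. *)
Lemma prune_ok k s s' :
  labels_ok E c T r s -> prune E c T k s s' -> labels_ok E c T r s'.
Proof.
move=> ok [->//|[nopt ->]]; case: ok => qf qs lr bp sk sp pe lt.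
split=> //=; try by move=> k' /setD1P[_]; auto.
move=> k' F1 F2 spl lk'; rewrite in_setD1.
have [def_k|_] := eqVneq k' k; last exact: (sk _ _ _ spl lk').
case: nopt; subst k'; case: k spl lk' => v I spl lk.
have [|F [bF sF vI wF]] := lr (v, I); first by apply: le_lt_trans lk _; apply: ltry.
have [|H [Hopt [H1 [sub1 def_F]]]] := @split_label_subtree _ _ E c hG hc T v I F F2.
- case: spl => sF1 sF2 _ vD opt; split=> //; apply: le_trans opt.
  by rewrite lee_fin lerD2r -lee_fin (le_trans wF).
by exists H; split=> //; exists H1; rewrite def_F.
Qed.

(** The premise quantifies over [b] to describe the updated pointers by what matters: the new entry
    at [k], and backtracking from permanent labels being preserved. *)
Lemma relax_ok k (x : \bar R) (B : {set label V}) s s' :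
    labels_ok E c T r s -> k.2 \subset T :\ r -> B \subset perm_set s ->
    (forall b : label V -> {set label V}, b k = B ->
       (forall k' F, k' \in perm_set s -> backtrack (bptr s) k' F -> backtrack b k' F) ->
       (x < +oo)%E -> realizes E c b k x) ->
    relax E c T k x B s s' ->
  [/\ labels_ok E c T r s', refines s s'
    & k \in perm_set s' \/ (lval s' k <= x)%E].
Proof.
move=> ok sk sB real; rewrite /relax; case: ifP => [/andP[lt_x nPk] | ]; last first.
  move=> /negbT; rewrite negb_and -leNgt negbK => /orP xk ->; split=> //.
  by case: xk; auto.
set s1 := State _ _ _ _ => pr.
have upd k' F : backtrack (bptr s) k' F -> k' != k -> backtrack (bptr s1) k' F.
  apply: backtrack_update => [k1 /negPf/= ->//|k1].
  by apply: contra nPk; apply: (subsetP (bptr_perm ok k1)).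
have ok1 : labels_ok E c T r s1.
  case: (ok) => qf qs lr bp skp sp pe lt; split=> //=.
  - by move=> k' /setU1P[->//|/qf].
  - by move=> k' /setU1P[->//|/qs].
  - move=> k'; have [->|kk'] /= := eqVneq k' k.
      apply: real => [|k1 F Pk1 bF]; first by rewrite /= eqxx.
      by apply: upd => //; apply: contraTneq Pk1 => ->.
    by move/lr => [F [bF *]]; exists F; split=> //; apply: upd.
  - by move=> k'; case: ifP.
  - move=> k' F1 F2 spl; rewrite in_setU1; case: eqP => //= _; exact: skp spl.
  - move=> k' F1 F2 spl Pk'; rewrite (negPf (_ : k' != k)); last first.
      by apply: contraTneq Pk' => ->.
    exact: sp spl Pk'.
  - move=> t Tt; case: eqP => [eq_k|_]; last exact: lt.
    by subst k; apply: le_trans (ltW lt_x) (lt _ Tt).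
have ref1 : refines s s1.
  split=> //= k'; first by case: eqP => [->|//]; apply: ltW.
  by move=> Pk'; rewrite (negPf (_ : k' != k)) //; apply: contraTneq Pk' => ->.
have eq_s' : lval s' = lval s1 /\ perm_set s' = perm_set s1 by case: pr => [->|[_ ->]].
case: eq_s' => eql eqP'; split; first exact: prune_ok ok1 pr.
  by case: ref1 => *; split; rewrite ?eql ?eqP'.
by right; rewrite eql /= eqxx.
Qed.

Lemma lval_ge0 s k : labels_ok E c T r s -> (0 <= lval s k)%E.
Proof.
move=> ok; have [lt_oo|] := boolP (lval s k < +oo)%E; last first.
  by rewrite ltey negbK => /eqP->; apply: leey.
have [F [_ sF _]] := lval_realized ok lt_oo.
by apply: le_trans; rewrite lee_fin (weight_ge0 hc).
Qed.

(** Nonnegativity excludes [-oo], whose sum with [+oo] is [-oo]. *)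
Lemma add_lty (x y : \bar R) :
  (0 <= x)%E -> (0 <= y)%E -> (x + y < +oo)%E -> (x < +oo)%E /\ (y < +oo)%E.
Proof. by case: x y => [x| |] [y| |] //=; rewrite !ltry. Qed.

Lemma edge_update_ok v I u s s' :
    labels_ok E c T r s -> I \subset T :\ r -> (v, I) \in perm_set s ->
    [set v; u] \in E -> edge_update E c T v I u s s' ->
  [/\ labels_ok E c T r s', refines s s' & edge_closed c s' v I u].
Proof.
move=> ok sI Pv Evu upd.
have [//||b bk keep lt_oo|ok' ref post] := relax_ok ok _ _ _ upd.
- by rewrite sub1set.
- have cE : (0 <= (c [set v; u])%:E)%E by rewrite lee_fin ltW ?hc.
  have [lt1 _] := add_lty (lval_ge0 _ ok) cE lt_oo.
  have [F [bF sF vI wF]] := lval_realized ok lt1.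
  exists ([set u; v] |: F); split.
  + by apply: (backtrack_edge bk); apply: keep.
  + by rewrite subUset sub1set setUC Evu.
  + apply: (@reach_trans _ _ _ v); first by apply: connect_adj1; rewrite setU11.
    by apply: reachS vI; rewrite ?subsetUr.
  + rewrite addeC; apply: le_trans (leeD2l _ wF); rewrite -EFinD lee_fin.
    by rewrite [[set v; u]]setUC (weightU1 hc) // setUC.
case: (ref) => eqP' _ eql; split=> //.
by rewrite /edge_closed (eql (v, I)) ?Pv.
Qed.

Lemma merge_update_ok v I J s s' :
    labels_ok E c T r s -> I \subset T :\ r -> (v, I) \in perm_set s ->
    J != set0 -> J \subset (T :\ r) :\: I -> (v, J) \in perm_set s ->
    merge_update E c T v I J s s' ->
  [/\ labels_ok E c T r s', refines s s' & merge_closed s' v I J].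
Proof.
move=> ok sI PI J0 /subsetDP[sJ dJI] PJ upd.
have [||b bk keep lt_oo|ok' ref post] := relax_ok ok _ _ _ upd.
- by rewrite subUset sI.
- by rewrite subUset !sub1set PI.
- have [lt1 lt2] := add_lty (lval_ge0 _ ok) (lval_ge0 _ ok) lt_oo.
  have [F [bF sF vI wF]] := lval_realized ok lt1.
  have [F' [bF' sF' vJ wF']] := lval_realized ok lt2.
  exists (F :|: F'); split.
  (* The two labels differ: otherwise the nonempty [J] would be disjoint from itself. *)
  + apply: backtrack_merge bk _ (keep _ _ PI bF) (keep _ _ PJ bF').
    apply: contraNneq J0 => -[eqIJ]; move: dJI; rewrite eqIJ.
    by rewrite -setI_eq0 setIid.
  + by rewrite subUset sF.
  + rewrite reachU (reachS _ _ vI) ?subsetUl // (reachS _ _ vJ) ?subsetUr //.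
  + by apply: le_trans (leeD wF wF'); rewrite -EFinD lee_fin (weightU hc).
case: (ref) => eqP' _ eql; split=> //.
by rewrite /merge_closed (eql (v, I)) ?(eql (v, J)).
Qed.
End Algorithm.

(** * Finding a queued label from an optimal split *)

Section Descent.
Variables (R : realType) (V : finType) (E : {set {set V}}) (c : {set V} -> R).
Variables (T : {set V}) (r : V) (L : V -> {set V} -> R).
Hypothesis hG : is_graph ([set: V], E).
Hypothesis hc : forall e, e \in E -> 0 < c e.
Hypothesis hr : r \in T.
Hypothesis hL : valid_lower_bound E c T r L.
Local Notation w := (weight c).
Implicit Types (s : state R V) (k : label V) (I J : {set V}) (F : {set {set V}}).

(** Validity of [L] is applied to the complements [T :\: I] and [T :\: J], whose difference is
    [I :\: J]; [F] connects this difference with [v] and [u], which bounds the [smt] term. *)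
Lemma lower_bound_shift v u I J F :
    J \subset I -> I \subset T :\ r -> F \subset E -> reach F v (u |: (I :\: J)) ->
  L u (T :\: J) <= L v (T :\: I) + w F.
Proof.
move=> sJI /subsetD1P[sIT rI] sF vF; have [_ _ shift] := hL.
rewrite -lee_fin EFinD; apply: le_trans (shift u v (T :\: J) (T :\: I) _ _ _) _.
- by rewrite sub1set inE rI.
- exact: setDS.
- exact: subsetDl.
apply: leeD2l; apply: (smt_le hG hc sF (v := v)).
apply: (@reachS _ _ _ _ ((u |: (I :\: J)) :|: [set v])) (subxx _) _ _.
  apply/subsetP => x; rewrite !inE; case: (x == u) => //=.
  case: (x == v); rewrite ?orbT //=.
  by rewrite !orbF negb_and negbK; case: (x \in I) (x \in J) (x \in T) => [] [] [].
by rewrite reachU vF reach1 connect0.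
Qed.

(** Induction on the number of edges of [F1] plus the number of terminals of the label. A recursive
    call either loses the edge [e] or has fewer terminals and no more edges; where the label
    changes, [lower_bound_shift] keeps the key bound from growing. *)
Lemma descent s k F1 F2 :
    invariant E c T r s -> optimal_split E c T k F1 F2 -> k.2 \subset T :\ r ->
  k \in perm_set s \/
  exists2 k', k' \in queue s &
    (lval s k' + (L k'.1 (T :\: k'.2))%:E <= (w F1 + L k.1 (T :\: k.2))%:E)%E.
Proof.
move=> [ok closedE closedM].
have [n] := ubnP (#|F1| + #|k.2|); elim: n k F1 F2 => // n IHn [v I] F1 F2 /=.
rewrite ltnS => le_n spl sIT.
have [sF1 sF2 /= vI vD opt] := spl.
(* By [split_kept] a value this low makes the label queued or permanent; if queued, it is its own
   witness. *)
have found : (lval s (v, I) <= (w F1)%:E)%E -> (v, I) \in perm_set s \/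
    exists2 k', k' \in queue s &
      (lval s k' + (L k'.1 (T :\: k'.2))%:E <= (w F1 + L v (T :\: I))%:E)%E.
  move=> lk; have /orP[Nk|Pk] := split_kept ok spl lk; [right | by left].
  by exists (v, I) => //; rewrite EFinD leeD2r.
(* Carries a witness found for another label over to [(v, I)]. *)
have relay k x : k \in perm_set s \/ (exists2 k', k' \in queue s &
      (lval s k' + (L k'.1 (T :\: k'.2))%:E <= (x + L k.1 (T :\: k.2))%:E)%E) ->
    x + L k.1 (T :\: k.2) <= w F1 + L v (T :\: I) ->
    k \in perm_set s \/ exists2 k', k' \in queue s &
      (lval s k' + (L k'.1 (T :\: k'.2))%:E <= (w F1 + L v (T :\: I))%:E)%E.
  move=> [Pk|[k' Nk' le_k']] le_x; [by left | right; exists k' => //].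
  by apply: le_trans le_k' _; rewrite lee_fin.
have [u F1vu|no_edge] := pickP (fun u => [set v; u] \in F1); last first.
  (* With no edge of [F1] at [v], no terminal other than [v] is reached, so the label is one of
     those set at initialization. *)
  have Iv : I \subset [set v].
    apply/subsetP => x /(reachP _ _ _ vI)/connectP[[_ ->|u p /= /andP[vu]]].
      by rewrite inE.
    by have := no_edge u; rewrite [_ \in F1]vu.
  move: Iv; rewrite subset1 => /orP[]/eqP def_I; subst I.
    apply: found; apply: le_trans (lval_terminal ok _) _.
      by rewrite (subsetP sIT) ?set11.
    by rewrite lee_fin (weight_ge0 hc).
  by left; apply: perm_empty ok v.
set e := [set v; u] in F1vu.
set F' := F1 :\ e.
have Ee : e \in E by apply: (subsetP sF1).
have sF'1 : F' \subset F1 by apply: subD1set.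
have sF' : F' \subset E by apply: subset_trans sF1.
have wF1 : w F1 = c e + w F' by apply: weightD1.
have cardF1 : #|F1| = #|F'|.+1 by rewrite (cardsD1 e) F1vu.
have ce := hc Ee.
have lt_n : (#|F'| + #|I| < n)%N by apply: leq_trans le_n; rewrite cardF1.
(* Without e, the terminals Iv are still joined to v, and the others to u.  If
   one of the two parts is empty, either F1 shrinks or an edge step along e
   applies; otherwise a merge step at v does. *)
pose Iv := [set x in I | connect (adj F') v x]; pose Iu := I :\: Iv.
have sIv : Iv \subset I by apply/subsetP => x; rewrite inE => /andP[].
have sIu : Iu \subset I by apply: subsetDl.
have vIv : reach F' v Iv by apply/reachP => x; rewrite inE => /andP[].
have uIu : reach F' u Iu.
  apply/reachP => x; rewrite !inE => /andP[nvx Ix].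
  by have := connect_setD1 u (reachP _ _ _ vI x Ix); move: nvx; rewrite Ix /= => /negPf->.
have ve F : e \in F -> connect (adj F) v u by apply: connect_adj1.
have [Iu0|Iu0] := eqVneq Iu set0.
  have eqI : Iv = I by apply/eqP; rewrite eqEsubset sIv -setD_eq0 -/Iu Iu0 eqxx.
  have spv : optimal_split E c T (v, I) F' F2.
    split=> //=; first by rewrite -eqI.
    by apply: le_trans opt; rewrite lee_fin wF1; lra.
  apply: (relay (v, I) (w F')) => /=; last by rewrite wF1; lra.
  exact: (IHn (v, I) F' F2).
have [Iv0|Iv0] := eqVneq Iv set0.
  have eqI : Iu = I by rewrite /Iu Iv0 setD0.
  have wU : w (e |: F2) <= c e + w F2 by apply: (weightU1 hc).
  (* The edge [e] changes sides: from [u] it leads through [v] to the terminals outside [I]. *)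
  have spu : optimal_split E c T (u, I) F' (e |: F2).
    split=> //=; [by rewrite subUset sub1set Ee | by rewrite -eqI | |].
      apply: (@reach_trans _ _ _ v); first by rewrite connect_adj_sym ve ?setU11.
      by apply: reachS vD; rewrite ?subsetUr.
    by apply: le_trans opt; rewrite lee_fin wF1; lra.
  have [|Pu|] := relay (u, I) (w F') (IHn (u, I) F' (e |: F2) lt_n spu sIT).
  - have := @lower_bound_shift v u I I [set e] (subxx _) sIT.
    have we : w [set e] = c e by rewrite /weight big_set1.
    rewrite sub1set setDv setU0 reach1 we wF1 => /(_ Ee (ve _ (set11 e))).
    by rewrite /=; lra.
  - case: (closedE u v I) => //; [by rewrite setUC | by left |].
    move=> le_l; apply: found; apply: le_trans le_l _.
    rewrite [[set u; v]]setUC -/e wF1 [c e + _]addrC EFinD leeD2r //.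
    by apply: split_perm ok _ _ _ spu Pu.
  - by right.
(* If [v] still reached [u], it would reach the terminals in [Iu]. Hence [F'] falls into a part at
   [v] and a part serving [u]. *)
have nvu : ~~ connect (adj F') v u.
  have [x Iux] := set0Pn _ Iu0; have := reachP _ _ _ uIu x Iux.
  move: Iux; rewrite !inE => /andP[nvx Ix] ux; move: nvx; rewrite Ix /=.
  by apply: contra => vu; apply: connect_trans vu ux.
set Fv := near_part F' v; set Fu := F' :\: Fv.
have sFv : Fv \subset F' by apply/subsetP => f; rewrite inE => /andP[].
have sFu : Fu \subset F' by apply: subsetDl.
have sFvE := subset_trans sFv sF'; have sFuE := subset_trans sFu sF'.
have wF' : w F' = w Fv + w Fu by apply: weight_near_far.
have vFv : reach Fv v Iv by apply: near_part_reach.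
have uFu : reach Fu u Iu by apply: far_part_reach.
set Fe := e |: Fu.
have sFe : Fe \subset E by rewrite subUset sub1set Ee.
have wFe : w Fe <= c e + w Fu by apply: (weightU1 hc).
have vFe : reach Fe v (u |: Iu).
  rewrite reachU reach1 ve ?setU11 //=.
  apply: (@reach_trans _ _ _ u); first by rewrite ve ?setU11.
  by apply: reachS uFu; rewrite ?subsetUr.
have DIv : I :\: Iu = Iv by rewrite setDDr setDv set0U; apply/setIidPr.
have rest (F G : {set {set V}}) (X Y : {set V}) :
    reach F v (T :\: I) -> reach G v Y -> X \subset I -> I :\: X = Y ->
    reach (F :|: G) v (T :\: X).
  move=> vF vG sXI def_Y; apply: (@reachS _ _ _ _ ((T :\: I) :|: Y)) (subxx _) _ _.
    rewrite -def_Y; apply/subsetP => x; rewrite !inE.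
    by case: (x \in I); case: (x \in X); case: (x \in T).
  by rewrite reachU (reachS _ _ vF) ?subsetUl // (reachS _ _ vG) ?subsetUr.
(* [F1] is divided into [Fv] and [Fe]; each serves in turn as first side while the other joins
   [F2]. *)
have spv : optimal_split E c T (v, Iv) Fv (F2 :|: Fe).
  split=> //=; first by rewrite subUset sF2.
    by apply: (rest _ _ _ Iu) => //; apply: reachS vFe; rewrite ?subsetUr.
  have := weightU hc F2 sFe; move=> wUF.
  by apply: le_trans opt; rewrite lee_fin wF1; lra.
have spu : optimal_split E c T (v, Iu) Fe (F2 :|: Fv).
  split=> //=; first by rewrite subUset sF2.
  - by apply: reachS vFe; rewrite ?subsetUr.
  - by apply: (rest _ _ _ Iv).
  have := weightU hc F2 sFvE; move=> wUF.
  by apply: le_trans opt; rewrite lee_fin wF1; lra.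
have sIvT := subset_trans sIv sIT; have sIuT := subset_trans sIu sIT.
have ltv : (#|Fv| + #|Iv| < n)%N.
  by apply: leq_ltn_trans lt_n; rewrite leq_add ?subset_leq_card.
have ltu : (#|Fe| + #|Iu| < n)%N.
  apply: leq_trans le_n; rewrite -addnS leq_add //.
    by rewrite subset_leq_card // subUset sub1set F1vu (subset_trans sFu).
  by rewrite -(cardsID Iv I) (setIidPr sIv) -add1n leq_add2r card_gt0.
have [|Pv|] := relay (v, Iv) (w Fv) (IHn (v, Iv) Fv (F2 :|: Fe) ltv spv sIvT).
- have := @lower_bound_shift v v I Iv Fe sIv sIT sFe.
  rewrite reachU reach1 connect0 (reachS _ _ vFe) ?subsetUr //= wF1 wF' => /(_ erefl).
  by lra.
- have [|Pu|] := relay (v, Iu) (w Fe) (IHn (v, Iu) Fe (F2 :|: Fv) ltu spu sIuT).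
  + have := @lower_bound_shift v v I Iu Fv sIu sIT sFvE.
    by rewrite reachU reach1 connect0 DIv vFv /= wF1 wF' => /(_ erefl); lra.
  (* Unless [(v, I)] is permanent already, the closed merge bounds its value by the costs of [Fv]
     and [Fe], together at most that of [F1]. *)
  + case: (closedM v Iv Iu) => //; first by apply: setSD.
      by rewrite -{1}(setIidPr sIv) setID; left.
    rewrite -{1}(setIidPr sIv) setID => le_l; apply: found; apply: le_trans le_l _.
    have lv := split_perm ok spv Pv; have lu := split_perm ok spu Pu.
    by apply: le_trans (leeD lv lu) _; rewrite lee_fin wF1; lra.
  + by right.
- by right.
Qed.
End Descent.

(** * Runs *)

Section Runs.
Variables (R : realType) (V : finType) (E : {set {set V}}) (c : {set V} -> R).
Variables (T : {set V}) (r : V) (L : V -> {set V} -> R).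
Hypothesis hG : is_graph ([set: V], E).
Hypothesis hconn : connected_graph ([set: V], E).
Hypothesis hc : forall e, e \in E -> 0 < c e.
Hypothesis hr : r \in T.
Hypothesis hL : valid_lower_bound E c T r L.
Implicit Types (s : state R V) (k : label V) (I J : {set V}) (F : {set {set V}}).

Lemma init_invariant : invariant E c T r (init_state R T r).
Proof.
have permE v I : ((v, I) \in perm_set (init_state R T r)) = (I == set0).
  by apply/imsetP/eqP=> [[u _ [_ ->]]|->] //; exists v; rewrite ?inE.
have queueE v I : ((v, I) \in queue (init_state R T r)) =
    (v \in T :\ r) && (I == [set v]).
  apply/imsetP/andP=> [[u Tu [-> ->]]|[Tv /eqP->]]; first by rewrite Tu eqxx.
  by exists v.
have lvalE k : lval (init_state R T r) k =
    if (k \in queue (init_state R T r)) || (k \in perm_set (init_state R T r))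
    then 0%E else +oo%E by [].
split; last 2 first.
- by move=> v u I _; rewrite permE => /eqP->; left; rewrite permE.
- by move=> v I J I0 _ _ _; rewrite permE (negPf I0).
split.
- by move=> [v I]; rewrite queueE permE => /andP[_ /eqP->]; rewrite -cards_eq0 cards1.
- by move=> [v I]; rewrite queueE => /andP[Tv /eqP->]; rewrite sub1set.
- move=> [v I]; rewrite lvalE; case: ifP => // + _; rewrite queueE permE => vI.
  exists set0; split; [exact: backtrack_leaf | exact: sub0set | |].
    2: by rewrite /weight big_set0.
  case/orP: vI => [/andP[_]|] /eqP->; last by apply/reachP => x; rewrite inE.
  by rewrite reach1 connect0.
- by move=> k; apply: sub0set.
- by move=> k F1 F2 _; rewrite lvalE; case: ifP.
- move=> k F1 F2 [sF1 _ _ _ _] Pk; rewrite lvalE Pk orbT lee_fin.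
  exact: (weight_ge0 hc sF1).
- by move=> v; rewrite permE.
- by move=> t Tt; rewrite lvalE queueE Tt eqxx.
Qed.

Lemma edge_closed_transfer s s' v I u :
    perm_set s \subset perm_set s' -> (forall k, (lval s' k <= lval s k)%E) ->
    lval s' (v, I) = lval s (v, I) -> edge_closed c s v I u ->
  edge_closed c s' v I u.
Proof.
move=> sP le_l eq_l [Pu|le_u]; [left | right]; first exact: (subsetP sP).
by rewrite eq_l; apply: le_trans le_u.
Qed.

Lemma merge_closed_transfer s s' v I J :
    perm_set s \subset perm_set s' -> (forall k, (lval s' k <= lval s k)%E) ->
    lval s' (v, I) = lval s (v, I) -> lval s' (v, J) = lval s (v, J) ->
    merge_closed s v I J ->
  merge_closed s' v I J.
Proof.
move=> sP le_l eqI eqJ [Pu|le_u]; [left | right]; first exact: (subsetP sP).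
by rewrite eqI eqJ; apply: le_trans le_u.
Qed.

Definition settle s k : state R V :=
  {| lval := lval s; bptr := bptr s; queue := queue s :\ k;
     perm_set := k |: perm_set s |}.

(** The point is [split_perm] for the chosen label: if its value exceeded the cost of [F1], the
    queued label given by [descent] would have a smaller key, against the choice. *)
Lemma settle_ok s k :
  invariant E c T r s -> chosen T L s k -> labels_ok E c T r (settle s k).
Proof.
move=> inv [Nk kmin]; have [ok _ _] := inv.
have nPk := queue_fresh ok Nk.
split=> /=.
- move=> k' /setD1P[neq Nk']; rewrite in_setU1 negb_or neq /=.
  exact: (queue_fresh ok Nk').
- by move=> k' /setD1P[_ Nk']; exact: (queue_sub ok Nk').
- exact: (lval_realized ok).
- by move=> k'; apply: subset_trans (bptr_perm ok k') (subsetUr _ _).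
- move=> k' F1 F2 spl lk'; rewrite in_setD1 in_setU1.
  by case: eqP => //= _; exact: (split_kept ok spl lk').
- move=> k' F1 F2 spl /setU1P[def_k|]; last exact: (split_perm ok spl).
  subst k'; rewrite leNgt; apply/negP => lt_k.
  have [Pk|[k' Nk' le_k']] := descent hG hc hr hL inv spl (queue_sub ok Nk).
    by rewrite Pk in nPk.
  have := le_trans (kmin _ Nk') le_k'; apply/negP; rewrite -ltNge EFinD.
  by rewrite lteD2rE.
- by move=> v; apply/setU1P; right; exact: (perm_empty ok v).
- exact: (lval_terminal ok).
Qed.

(** Only closures involving the newly permanent label are new, and the two loops provide them; older
    ones carry over because permanent values are frozen and other values only decrease. *)
Lemma iteration_invariant s s' :
    invariant E c T r s -> iteration E c T r L s s' ->
  invariant E c T r s' /\ (#|perm_set s| < #|perm_set s'|)%N.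
Proof.
move=> inv [v [I [ch [s1 [run1 run2]]]]].
have [ok closedE closedM] := inv; have [NvI _] := ch.
have sIT := queue_sub ok NvI; have nPvI := queue_fresh ok NvI.
have ok0 := settle_ok inv ch; set s0 := settle s (v, I) in ok0.
rewrite -[State _ _ _ _]/s0 in run1.
have P0 : (v, I) \in perm_set s0 by apply: setU11.
pose Q s2 s3 := labels_ok E c T r s3 /\ refines s2 s3.
have [[ok1 ref1] post1] : Q s0 s1 /\ forall u, u \in [set u | [set v; u] \in E] ->
    edge_closed c s1 v I u.
  apply: (for_every_post (Q := Q s0) (Post := fun u s => edge_closed c s v I u)
    _ _ run1) => [u s2 s3|]; last by split=> //; apply: refines_refl.
  rewrite inE => Evu [ok2 ref2] up; have [eqP2 _ _] := ref2.
  have P2 : (v, I) \in perm_set s2 by rewrite eqP2.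
  have [ok3 ref3 cl3] := edge_update_ok hG hc ok2 sIT P2 Evu up.
  split=> // [|y]; first by split=> //; apply: refines_trans ref3.
  by have [eqP3 le3 eq3] := ref3; apply: edge_closed_transfer => //; rewrite ?eqP3 ?eq3.
have [eqP1 le1 eq1] := ref1.
have [[ok' ref2] post2] : Q s1 s' /\ forall J, J \in [set J : {set V} |
      [&& J != set0, J \subset (T :\ r) :\: I & (v, J) \in perm_set s1]] ->
    (v, J) \in perm_set s' -> merge_closed s' v I J.
  (* The premise that [(v, J)] is permanent freezes its value, so that a closed merge stays closed
     in later passes. *)
  apply: (for_every_post (Q := Q s1)
    (Post := fun J s => (v, J) \in perm_set s -> merge_closed s v I J)
    _ _ run2) => [J s2 s3|]; last by split=> //; apply: refines_refl.
  rewrite inE => /and3P[J0 sJ PJ] [ok2 ref2] up; have [eqP2 _ _] := ref2.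
  have P2 : (v, I) \in perm_set s2 by rewrite eqP2 eqP1.
  have PJ2 : (v, J) \in perm_set s2 by rewrite eqP2.
  have [ok3 ref3 cl3] := merge_update_ok hG hc ok2 sIT P2 J0 sJ PJ2 up.
  split=> // [|y]; first by split=> //; apply: refines_trans ref3.
  have [eqP3 le3 eq3] := ref3; rewrite eqP3 => cl Py.
  by apply: merge_closed_transfer (cl Py); rewrite ?eqP3 ?eq3.
have [eqP2 le2 eq2] := ref2.
have eqP' : perm_set s' = (v, I) |: perm_set s by rewrite eqP2 eqP1.
have le' k : (lval s' k <= lval s k)%E by apply: le_trans (le2 k) (le1 k).
have sP : perm_set s \subset perm_set s' by rewrite eqP' subsetUr.
have eq' k : k \in perm_set s -> lval s' k = lval s k.
  by move=> Pk; rewrite eq2 ?eq1 ?eqP1 // inE Pk orbT.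
have merge_new J : J != set0 -> J \subset (T :\ r) :\: I -> (v, J) \in perm_set s' ->
    merge_closed s' v I J.
  by move=> J0 sJ PJ; apply: post2; rewrite ?inE ?J0 ?sJ -?eqP2.
split; last by rewrite eqP' cardsU1 nPvI.
split=> //.
- move=> v' u I' Ev'u; rewrite eqP' => /setU1P[[eq_v def_I]|Pv'].
    subst v' I'; apply: (@edge_closed_transfer s1) => //; rewrite ?eqP2 ?eq2 ?eqP1 //.
    by apply: post1; rewrite inE.
  by apply: (@edge_closed_transfer s); rewrite ?eq' //; apply: closedE.
- move=> v' I' J I0 J0 sI' sJ PI PJ.
  have [sJT dJ] := subsetDP sJ.
  have:= PI; rewrite eqP' => /setU1P[[eq_v eq_I]|PI']; first by subst; apply: merge_new.
  have:= PJ; rewrite eqP' => /setU1P[[eq_v eq_J]|PJ']; last first.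
    by apply: (@merge_closed_transfer s); rewrite ?eq' //; apply: closedM.
  (* The newly permanent label is the second one here; the loop tried this merge with the roles
     exchanged. *)
  subst; rewrite /merge_closed setUC addeC; apply: merge_new => //.
  by apply/subsetDP; rewrite disjoint_sym.
Qed.

(** Only [r] remains outside [T :\ r], and the label sits at [r], so an optimum Steiner tree with an
    empty second side is a split. *)
Lemma terminal_split : exists F, optimal_split E c T (r, T :\ r) F set0.
Proof.
have [F [sF rF optF]] := smt_attained c hG hconn hr.
exists F; split=> //=; first exact: sub0set.
- by apply: reachS rF => //; apply: subsetDl.
- rewrite setDDr setDv set0U; apply/reachP => x; rewrite !inE => /andP[_ /eqP->].
  exact: connect0.
- by rewrite [X in _ + X]/weight big_set0 addr0.
Qed.

Lemma relax_total k (x : \bar R) (B : {set label V}) s :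
  exists s', relax E c T k x B s s'.
Proof.
rewrite /relax; case: ((x < lval s k)%E && (k \notin perm_set s)); last by exists s.
(* Leaving the queue unchanged is always a permitted outcome of pruning. *)
by eexists; left.
Qed.

(** [descent] for the final label shows that the queue is nonempty, so some label minimizes the
    key. *)
Lemma loop_progress s :
  invariant E c T r s -> ~ finished T r s -> exists s', loop_step E c T r L s s'.
Proof.
move=> inv nfin; have [F spl] := terminal_split.
have [//|[k0 Nk0 _]] := descent hG hc hr hL inv spl (subxx _).
pose key k : \bar R := (lval s k + (L k.1 (T :\: k.2))%:E)%E.
have [[v I] /= Nk kmin] := @arg_minP _ _ _ k0 (mem (queue s)) key Nk0.
have [s1 run1] : exists s1, for_every [set u | [set v; u] \in E]
    (edge_update E c T v I) (settle s (v, I)) s1.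
  by apply: for_every_total => u s1; apply: relax_total.
have [s' run2] : exists s', for_every
    [set J : {set V} | [&& J != set0, J \subset (T :\ r) :\: I & (v, J) \in perm_set s1]]
    (merge_update E c T v I) s1 s'.
  by apply: for_every_total => J s2; apply: relax_total.
exists s'; split=> //; exists v, I; split; first by split.
by exists s1.
Qed.

(** By [split_perm] the final value is at most [smt]; the backtracked set costs no more and connects
    [T]. *)
Lemma finished_optimum s :
    invariant E c T r s -> finished T r s ->
  exists F, backtrack (bptr s) (r, T :\ r) F /\
    optimum_steiner_tree E c T (component F r).
Proof.
move=> [ok _ _] fin; have [F0 spl] := terminal_split.
have le0 := split_perm ok spl fin.
have [F [bF sF rF wF]] := lval_realized ok (le_lt_trans le0 (ltry _)).
exists F; split=> //; apply: reach_optimum => //.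
  by rewrite -(setD1K hr) reachU reach1 connect0.
case: spl => _ _ _ _; apply: le_trans; apply: le_trans wF (le_trans le0 _).
by rewrite [X in _ + X]/weight big_set0 addr0.
Qed.

Lemma run_invariant s s' :
    clos_refl_trans (state R V) (loop_step E c T r L) s s' ->
  invariant E c T r s -> invariant E c T r s'.
Proof.
elim=> {s s'} [s s' [_ it] inv|//|s1 s2 s3 _ IH12 _ IH23 /IH12/IH23//].
by have [] := iteration_invariant inv it.
Qed.

(** Each iteration makes one more label permanent, and there are finitely many labels. *)
Lemma loop_terminates s :
  invariant E c T r s -> Acc (fun s' s => loop_step E c T r L s s') s.
Proof.
have [n] := ubnP #|~: perm_set s|.
elim: n s => [s|n IHn s le_n inv]; first by rewrite ltn0.
constructor=> s' [_ it]; have [inv' lt_P] := iteration_invariant inv it.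
apply: IHn => //; rewrite ltnS in le_n; apply: leq_trans le_n.
rewrite (cardsCs (~: perm_set s)) (cardsCs (~: perm_set s')) !setCK.
by rewrite ltn_sub2l // (leq_trans lt_P) ?max_card.
Qed.
End Runs.

(* In order: every run is finite; no run gets stuck before the loop exits; after
   the loop exits, backtracking terminates, and what it returns is the edge set
   of an optimum Steiner tree. *)
Theorem theorem4 (R : realType) (V : finType) (E : {set {set V}})
    (c : {set V} -> R) (T : {set V}) (r : V) (L : V -> {set V} -> R)
    (hG : is_graph ([set: V], E))
    (hconn : connected_graph ([set: V], E))
    (hc : forall e, e \in E -> 0 < c e)
    (hr : r \in T)
    (hL : valid_lower_bound E c T r L) :
  Acc (fun s' s : state R V => loop_step E c T r L s s') (init_state R T r) /\
  forall s : state R V,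
    clos_refl_trans (state R V) (loop_step E c T r L) (init_state R T r) s ->
    (~ finished T r s -> exists s', loop_step E c T r L s s') /\
    (finished T r s ->
       (exists F, backtrack (bptr s) (r, T :\ r) F) /\
       (forall F, backtrack (bptr s) (r, T :\ r) F ->
          exists H, optimum_steiner_tree E c T H /\ H.2 = F)).
Proof.
have inv0 := init_invariant T r hc.
split; first exact: loop_terminates.
move=> s /run_invariant inv_s; have inv := inv_s hG hc hr hL inv0.
split; first exact: loop_progress.
move=> fin; have [F [bF optF]] := finished_optimum hG hconn hc hr inv fin.
split=> [|F' bF']; first by exists F.
by exists (component F r); split=> //; apply: backtrack_fun bF bF'.
Qed.
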